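(* Let $\mathcal{G}$ be a family of graphs of bounded degree (i.e. there is $\Delta\in\mathbb N$ such that every graph in $\mathcal G$ has maximum degree at most $\Delta$) that is closed under taking induced subgraphs, and let $\lambda^\star>0$. If the hard-core model on $\mathcal{G}$ satisfies very strong spatial mixing (VSSM) at $\lambda^\star$, then there exists an open set $U\subseteq \mathbb{C}$ containing $\lambda^\star$ such that $Z_G(\lambda)\neq 0$ for all $\lambda \in U$ and every graph $G\in \mathcal{G}$.
   Context: All graphs are finite and simple; $\mathbb N=\{1,2,\dots\}$. For a graph $G=(V,E)$, $\mathcal I_G$ is the collection of independent sets of $G$ and $Z_G(\lambda)=\sum_{I\in\mathcal I_G}\lambda^{|I|}$. For $v\in V$ and $\ell\in\mathbb N$, $S_G(v,\ell)$ is the set of vertices at distance exactly $\ell$ from $v$ in $G$. Boundary conditions and ratios: a boundary condition on $G$ is a map $\sigma:V_\sigma\to\{0,1\}$ with $V_\sigma\subset V$ such that $V_{\sigma,\mathrm{in}}:=\sigma^{-1}(1)$ is independent in $G$. For $v\in V\setminus V_\sigma$ put $$Z^{v\,\mathrm{in}}_{(G,\sigma)}(\lambda)=\sum_{\substack{v\in I\subseteq V\setminus V_\sigma\\ I\cup V_{\sigma,\mathrm{in}}\in\mathcal I_G}}\lambda^{|I|},\qquad Z^{v\,\mathrm{out}}_{(G,\sigma)}(\lambda)=\sum_{\substack{v\notin I\subseteq V\setminus V_\sigma\\ I\cup V_{\sigma,\mathrm{in}}\in\mathcal I_G}}\lambda^{|I|},\qquad R_{(G,\sigma),v}(\lambda)=\frac{Z^{v\,\mathrm{in}}_{(G,\sigma)}(\lambda)}{Z^{v\,\mathrm{out}}_{(G,\sigma)}(\lambda)}.$$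 Tree of self avoiding walks: fix a total ordering of the vertices of $G$ (inherited by induced subgraphs). For a vertex $v$ of $G$ the rooted tree $T_{\mathrm{SAW}(G,v)}$ (with root $v$) is defined recursively. If the component of $G$ containing $v$ is $\{v\}$, then $T_{\mathrm{SAW}(G,v)}$ is the single vertex $v$. Otherwise let $v_1,\dots,v_d$ be the neighbours of $v$ in $G$ (listed in increasing order), let $G_i$ be obtained from $G$ by removing $v,v_1,\dots,v_{i-1}$, and let $T_i=T_{\mathrm{SAW}(G_i,v_i)}$; then $T_{\mathrm{SAW}(G,v)}$ is obtained from the disjoint union of $T_1,\dots,T_d$ by adding a root vertex $v$ joined to the root $v_i$ of each $T_i$. VSSM: the hard-core model on a family $\mathcal G$ of bounded degree graphs satisfies VSSM at $\lambda>0$ if there exist constants $\alpha\in[0,1)$ and $C>0$ such that for all $G\in\mathcal G$, every induced subgraph $H$ of $G$, every $v\in V(H)$, every $\ell\in\mathbb N$ and all boundary conditions $\sigma,\tau:S_{T}(v,\ell)\to\{0,1\}$ with $T=T_{\mathrm{SAW}(H,v)}$, we have $|R_{(T,\sigma),v}(\lambda)-R_{(T,\tau),v}(\lambda)|\le C\alpha^\ell$. *)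

(* Defs.v *)
From HB Require Import structures.
From mathcomp Require Import all_boot all_order all_algebra.
From mathcomp Require Import reals.

Set Implicit Arguments.
Unset Strict Implicit.
Unset Printing Implicit Defensive.

Import Order.TTheory GRing.Theory Num.Theory.
Local Open Scope ring_scope.

Record sgraph := SGraph {
  vertex :> finType;
  adj : rel vertex;
  adj_sym : symmetric adj;
  adj_irr : irreflexive adj }.

Section Graph.
Variable G : sgraph.

Definition indep (I : {set G}) : bool :=
  [forall x in I, forall y in I, ~~ adj x y].

Definition walk (v u : G) (l : nat) : bool :=
  [exists p : l.-tuple G, path (@adj G) v p && (last v p == u)].

(* The vertices at distance exactly l: a walk of length l, none shorter. *)
Definition sphere (v : G) (l : nat) : {set G} :=
  [set u | walk v u l & [forall k : 'I_l, ~~ walk v u k]].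

Variable S : {set G}.

Definition induced_vertex : finType := {x : G | x \in S}.
Definition induced_adj : rel induced_vertex :=
  fun x y => adj (val x) (val y).

Lemma induced_adj_sym : symmetric induced_adj.
Proof. by move=> x y; apply: adj_sym. Qed.

Lemma induced_adj_irr : irreflexive induced_adj.
Proof. by move=> x; apply: adj_irr. Qed.

Definition induced : sgraph := SGraph induced_adj_sym induced_adj_irr.
End Graph.

(* [Some false] is the value 0, [Some true] the value 1; [None] means that the
   vertex lies outside the domain. *)
Record boundary_condition (G : sgraph) := BoundaryCondition {
  bc_val :> G -> option bool;
  bc_indep : indep [set x | bc_val x == Some true] }.

Section HardCore.
Variable K : fieldType.
Variable G : sgraph.

Definition Z (lam : K) : K := \sum_(I : {set G} | indep I) lam ^+ #|I|.

Variable sigma : boundary_condition G.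

Definition bc_dom : {set G} := [set x | sigma x != None].
Definition bc_in : {set G} := [set x | sigma x == Some true].

Definition Zin (v : G) (lam : K) : K :=
  \sum_(I : {set G} | [&& v \in I, I \subset ~: bc_dom & indep (I :|: bc_in)])
     lam ^+ #|I|.

Definition Zout (v : G) (lam : K) : K :=
  \sum_(I : {set G} | [&& v \notin I, I \subset ~: bc_dom
                        & indep (I :|: bc_in)]) lam ^+ #|I|.

Definition ratio (v : G) (lam : K) : K := Zin v lam / Zout v lam.
End HardCore.

Record rgraph := RGraph { rg_graph :> sgraph; root : rg_graph }.

Section Point.
Definition point_adj : rel unit := fun _ _ => false.
Lemma point_adj_sym : symmetric point_adj. Proof. by []. Qed.
Lemma point_adj_irr : irreflexive point_adj. Proof. by []. Qed.
Definition point : rgraph :=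
  @RGraph (@SGraph unit point_adj point_adj_sym point_adj_irr) tt.
End Point.

(* [graft A B]: the disjoint union of A and B together with an edge between the
   two roots, rooted at the root of A. *)
Section Graft.
Variables A B : rgraph.

Definition graft_adj : rel (A + B)%type := fun x y =>
  match x, y with
  | inl a, inl a' => adj a a'
  | inr b, inr b' => adj b b'
  | inl a, inr b | inr b, inl a => (a == root A) && (b == root B)
  end.

Lemma graft_adj_sym : symmetric graft_adj.
Proof. by move=> [a|b] [a'|b'] //=; apply: adj_sym. Qed.

Lemma graft_adj_irr : irreflexive graft_adj.
Proof. by move=> [a|b] /=; apply: adj_irr. Qed.

Definition graft : rgraph :=
  @RGraph (@SGraph (A + B)%type graft_adj graft_adj_sym graft_adj_irr)
          (inl (root A)).
End Graft.

(* The disjoint union of the members of [ts] and of a new root, joined to the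
   root of each member; the members are attached one at a time. *)
Definition join_root (ts : seq rgraph) : rgraph :=
  foldr (fun t acc => graft acc t) point ts.

(* Trees of self-avoiding walks of the induced subgraphs of a graph G, for the
   ordering induced by [le].  An induced subgraph is represented by its vertex
   set S, so that [tsaw S v] is T_SAW(G[S], v), meaningful for v \in S. *)
Section SAW.
Variables (G : sgraph) (le : rel G).

Definition nbrs (S : {set G}) (v : G) : seq G :=
  sort le (enum [set u in S | adj v u]).

(* S without v and without the first i neighbours of v. *)
Definition saw_sub (S : {set G}) (v : G) (i : nat) : {set G} :=
  S :\: [set u in v :: take i (nbrs S v)].

(* n is a bound on the recursion depth; see [tsawE]. *)
Fixpoint tsaw_rec (n : nat) (S : {set G}) (v : G) : rgraph :=
  if n is n'.+1 then
    join_root [seq tsaw_rec n' (saw_sub S v i) (nth v (nbrs S v) i)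
              | i <- iota 0 (size (nbrs S v))]
  else point.

Definition tsaw (S : {set G}) (v : G) : rgraph := tsaw_rec #|S| S v.

Lemma mem_nbrs (S : {set G}) v u : (u \in nbrs S v) = (u \in S) && adj v u.
Proof. by rewrite mem_sort mem_enum inE. Qed.

Lemma nbrs_uniq (S : {set G}) v : uniq (nbrs S v).
Proof. by rewrite sort_uniq enum_uniq. Qed.

Lemma mem_saw_sub (S : {set G}) v i :
  (i < size (nbrs S v))%N -> nth v (nbrs S v) i \in saw_sub S v i.
Proof.
move=> lti; have := mem_nth v lti; rewrite mem_nbrs => /andP[uS vu].
rewrite !inE uS andbT negb_or; apply/andP; split.
  by apply: contraTneq vu => ->; rewrite adj_irr.
apply/negP => /(nthP v)[j]; rewrite size_take lti => ltji.
rewrite nth_take // => /eqP.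
rewrite nth_uniq ?nbrs_uniq // ?(ltn_trans ltji lti) // => /eqP eji.
by rewrite eji ltnn in ltji.
Qed.

Lemma card_saw_sub (S : {set G}) v i : v \in S -> (#|saw_sub S v i| < #|S|)%N.
Proof.
move=> vS; apply: proper_card; apply/properP; split; first exact: subsetDl.
by exists v; rewrite // !inE eqxx.
Qed.

Lemma tsaw_rec_indep n m (S : {set G}) v : v \in S -> (#|S| <= n)%N -> (#|S| <= m)%N ->
  tsaw_rec n S v = tsaw_rec m S v.
Proof.
elim: n m S v => [|n IH] [|m] S v vS.
- by [].
- by rewrite leqNgt (cardD1 v) vS.
- by move=> _; rewrite leqNgt (cardD1 v) vS.
move=> Sn Sm /=; congr join_root; apply/eq_in_map => i.
rewrite mem_iota /= => lti; apply: IH; first exact: mem_saw_sub.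
  by rewrite -ltnS; apply: leq_trans Sn; apply: card_saw_sub.
by rewrite -ltnS; apply: leq_trans Sm; apply: card_saw_sub.
Qed.

(* The defining recursion.  When v is isolated in G[S] the list is empty and
   the right-hand side is [point]. *)
Lemma tsawE (S : {set G}) v : v \in S ->
  tsaw S v = join_root [seq tsaw (saw_sub S v i) (nth v (nbrs S v) i)
                       | i <- iota 0 (size (nbrs S v))].
Proof.
move=> vS; transitivity (tsaw_rec #|S|.+1 S v); first exact: tsaw_rec_indep.
rewrite /=; congr join_root; apply/eq_in_map => i; rewrite mem_iota /= => lti.
apply: tsaw_rec_indep => //; first exact: mem_saw_sub.
by rewrite ltnW // card_saw_sub.
Qed.
End SAW.

Definition bounded_degree (F : sgraph -> Prop) : Prop :=
  exists2 Delta : nat, (0 < Delta)%N &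
    forall G : sgraph, F G -> forall v : G, (#|[set u | adj v u]| <= Delta)%N.

Definition induced_closed (F : sgraph -> Prop) : Prop :=
  forall G : sgraph, F G -> forall S : {set G}, F (induced S).

Definition linear_order (T : Type) (le : rel T) : Prop :=
  [/\ reflexive le, antisymmetric le, transitive le & total le].

(* [ord] gives the fixed total ordering of the vertices of each graph; the
   induced subgraph H = G[S] inherits the ordering of G. *)
Definition VSSM (R : realType) (ord : forall G : sgraph, rel G)
    (F : sgraph -> Prop) (lam : R) : Prop :=
  exists alpha C : R,
    [/\ 0 <= alpha, alpha < 1, 0 < C &
      forall G : sgraph, F G ->
      forall (S : {set G}) (v : G), v \in S ->
      forall l : nat, (0 < l)%N ->
      let T := tsaw (ord G) S v in
      forall sigma tau : boundary_condition T,
        bc_dom sigma = sphere (root T) l ->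
        bc_dom tau = sphere (root T) l ->
        `|ratio sigma (root T) lam - ratio tau (root T) lam|
          <= C * alpha ^+ l].

(* Main.v *)
Require Import Defs.
From mathcomp Require Import all_boot all_order all_algebra.
From mathcomp Require Import complex.
From mathcomp Require Import lra ring.
From mathcomp Require Import classical_sets reals topology normedtype.
From mathcomp Require Import fintype finset interval_inference convex sequences exp.
Require Import Defs.
Import Order.TTheory GRing.Theory Num.Theory.
Import numFieldNormedType.Exports.
Local Open Scope ring_scope.
Local Open Scope complex_scope.

Set Implicit Arguments.
Unset Strict Implicit.
Unset Printing Implicit Defensive.

(** The ratio r_v = lambda Z(G - N[v]) / Z(G - v) of a vertex v obeys the
    recursion r_v = lambda / prod_i (1 + r_i) of the tree of self-avoiding walks,
    where r_i is the ratio of the i-th neighbour v_i in the graph G_i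
    ([vertex_ratioE], [tsaw_join_root]).  Since Z(G) = Z(G - v) (1 + r_v), zeros
    are excluded by keeping the complex ratios close to the positive ratios at
    lambda-star.

    Write p_i = r_i / (1 + r_i) for the occupation probabilities at lambda-star.
    To first order, a relative error e_i of the r_i produces the relative error
    eta - sum_i p_i e_i of r_v, where eta is that of lambda.  So one wants a
    weight h, bounded over the whole family, with h_v = 1 + sum_i p_i h_i: an
    error of at most delta h_i at each child then gives
    eta + delta (h_v - 1) + O(delta^2) at v, which is at most delta h_v once
    delta and eta / delta are small ([vertex_ratio_near]).  This is a one-step
    induction, so the dependence on lambda never has to be followed through a
    tree of large depth.

    The solution h of this recursion is the sum, over all descending paths from
    the root, of the product of the occupation probabilities met after the root
    ([influence]).  Very strong spatial mixing bounds it.  Put all-0 or all-1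
    values on the sphere of radius l + 2: the two resulting ratios bracket the
    true one at every vertex above the sphere, with an order alternating from one
    level to the next.  All differences within a level have the same sign, so
    there is no cancellation, and concavity of the logarithm bounds the difference
    of the log-ratios at v from below by the sum of p_i' times the difference at
    v_i, where p_i' is computed from the lower of the two ratios.  Mixing in a subtree whose
    root is at distance j from the sphere gives p_i <= p_i' (1 + M alpha^j), and
    the product of these factors converges.  Hence the paths of length l + 2
    contribute at most a constant times the difference of the log-ratios at the
    root ([path_weight_log_gap]), that is O(alpha^l) by mixing at the root, and the
    contributions are summable ([influence_le]). *)

(** * Elementary inequalities *)
Section Elementary.
Variable R : realType.

Definition occupation (r : R) : R := r / (1 + r).

Lemma occupation_ge0 r : 0 <= r -> 0 <= occupation r.
Proof. by move=> r0; rewrite divr_ge0 // addr_ge0. Qed.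

Lemma occupation_le1 r : 0 <= r -> occupation r <= 1.
Proof. by move=> r0; rewrite ler_pdivrMr ?mul1r ?lerDr // ltr_pwDl. Qed.

(** This is concavity of [ln]: (1 + x) / (1 + y) is the mean of x / y and 1 with
    weights y / (1 + y) and 1 / (1 + y). *)
Lemma ln1D_increment (x y : R) : 0 < y -> y <= x ->
  occupation y * (ln x - ln y) <= ln (1 + x) - ln (1 + y).
Proof.
rewrite /occupation.
move=> y0 yx; have x0 : 0 < x by exact: lt_le_trans yx.
have y1 : 0 < 1 + y by lra.
have x1 : 0 < 1 + x by lra.
have p01 : (0 <= y / (1 + y) <= 1)%R.
  by rewrite divr_ge0 ?(ltW y0) ?(ltW y1) //= ler_pdivrMr // mul1r; lra.
rewrite -!ln_div ?posrE //.
pose t : {i01 R} := Itv01 (andP p01).1 (andP p01).2.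
have := @concave_ln R t (x / y) 1 (divr_gt0 x0 y0) ltr01.
rewrite !convRE /= ln1 mulr0 addr0 mulr1.
suff -> : y / (1 + y) * (x / y) + unstable.onem (y / (1 + y)) = (1 + x) / (1 + y) by [].
by rewrite /unstable.onem; field; rewrite !gt_eqF.
Qed.

(** [occupation] is 1-Lipschitz, and is at least q / (1 + q) above q; this turns
    the additive error z into a relative one. *)
Lemma le_occupation (x y z q : R) : 0 < q -> q <= y -> y <= x -> x <= y + z ->
  occupation x <= occupation y * (1 + z * (1 + q) / q).
Proof.
rewrite /occupation.
move=> q0 qy yx xz.
have y0 : 0 < y by exact: lt_le_trans qy.
have x0 : 0 < x by exact: lt_le_trans yx.
have -> : x / (1 + x) = y / (1 + y) + (x - y) / ((1 + x) * (1 + y)).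
  by field; rewrite !gt_eqF //; lra.
rewrite [leRHS]mulrDr mulr1 lerD2l.
have pq : q / (1 + q) <= y / (1 + y).
  rewrite ler_pdivrMr ?addr_gt0 // mulrAC ler_pdivlMr ?addr_gt0 //.
  by rewrite !mulrDr !mulr1 [y * q]mulrC lerD2r.
have z0 : 0 <= z by lra.
apply: (@le_trans _ _ z).
  rewrite ler_pdivrMr ?mulr_gt0 ?addr_gt0 //; apply: (@le_trans _ _ z); first by lra.
  by rewrite ler_peMr // -[leLHS]mulr1 ler_pM //; lra.
apply: (@le_trans _ _ (q / (1 + q) * (z * (1 + q) / q))).
  rewrite le_eqVlt; apply/orP; left; apply/eqP; field.
  by rewrite !gt_eqF //; lra.
apply: ler_wpM2r pq.
by rewrite divr_ge0 ?mulr_ge0 //; lra.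
Qed.

Lemma sum_geometric_le (a : R) n : 0 <= a -> a < 1 ->
  \sum_(k < n) a ^+ k <= (1 - a)^-1.
Proof.
move=> a0 a1; rewrite -[leRHS]mul1r ler_pdivlMr ?subr_gt0 // mulrC.
have -> : (1 - a) * \sum_(k < n) a ^+ k = 1 - a ^+ n.
  by rewrite -opprB mulNr -subrX1 opprB.
by rewrite gerBl exprn_ge0.
Qed.

End Elementary.

(** * Spatial mixing bounds the influence of the descendants *)

(** The recursion is studied on an abstract set D of nodes with lists of
    children, so that no tree has to be unfolded. *)
Section TreeRecursion.
Variables (R : realType) (X : eqType) (ch : X -> seq X) (D : {pred X}).
Variables (lam alpha C : R) (Delta : nat) (rat : X -> R).
Hypothesis lam_gt0 : 0 < lam.
Hypothesis D_ch : forall x y, x \in D -> y \in ch x -> y \in D.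
Hypothesis size_ch : forall x, x \in D -> (size (ch x) <= Delta)%N.
Hypothesis rat_gt0 : forall x, x \in D -> 0 < rat x.
Hypothesis ratE : forall x, x \in D ->
  rat x = lam / \prod_(y <- ch x) (1 + rat y).

(** The ratio at x when all vertices at distance l + 1 below x get the value c.
    At distance 1 and with c = 1 a child forces x out, hence the ratio 0. *)
Fixpoint boundary_ratio (c : bool) (l : nat) (x : X) : R :=
  if l is l'.+1 then lam / \prod_(y <- ch x) (1 + boundary_ratio c l' y)
  else if c && (ch x != [::]) then 0 else lam.

(** The sum, over the descending paths of length k from x, of the product of the
    occupation probabilities of the vertices after x. *)
Fixpoint path_weight (k : nat) (x : X) : R :=
  if k is k'.+1 then \sum_(y <- ch x) occupation (rat y) * path_weight k' y
  else 1.

(** The sum of the path weights of length at most n, in recursive form.  With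
    the signs (-1)^k on the paths of length k it would be the derivative of ln r_x
    with respect to ln lambda. *)
Fixpoint influence (n : nat) (x : X) : R :=
  if n is n'.+1 then 1 + \sum_(y <- ch x) occupation (rat y) * influence n' y
  else 1.

(** The recursion reverses the order, so the boundary value giving the larger
    ratio depends on the parity of the distance. *)
Definition upper l := boundary_ratio (odd l) l.
Definition lower l := boundary_ratio (~~ odd l) l.
Definition log_gap l x := ln (upper l.+1 x) - ln (lower l.+1 x).

(** All ratios are at most lam, hence those with at most Delta children are at
    least this number. *)
Definition ratio_min : R := lam / (1 + lam) ^+ Delta.

Lemma upperS l x : upper l.+1 x = lam / \prod_(y <- ch x) (1 + lower l y).
Proof. by []. Qed.

Lemma lowerS l x : lower l.+1 x = lam / \prod_(y <- ch x) (1 + upper l y).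
Proof. by rewrite /lower /upper /= negbK. Qed.

Lemma boundary_ratio_ge0 c l x : 0 <= boundary_ratio c l x.
Proof.
elim: l x => [|l IH] x /=; first by case: ifP => // _; apply: ltW.
by rewrite divr_ge0 ?(ltW lam_gt0) // prodr_ge0 // => y _; rewrite addr_ge0.
Qed.

Lemma recursion_antitone (f g : X -> R) s :
  (forall y, y \in s -> 0 <= f y <= g y) ->
  lam / \prod_(y <- s) (1 + g y) <= lam / \prod_(y <- s) (1 + f y).
Proof.
move=> fg; have f1 : forall y, y \in s -> 1 <= 1 + f y.
  by move=> y /fg /andP[f0 _]; rewrite lerDl.
have P0 (h : X -> R) : (forall y, y \in s -> 0 <= h y) ->
    0 < \prod_(y <- s) (1 + h y).
  move=> h0; rewrite big_seq prodr_gt0 // => y /h0 hy.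
  by rewrite ltr_pwDl.
rewrite ler_pM2l // lef_pV2 ?posrE; last 2 first.
- by apply: P0 => y /fg /andP[f0 /(le_trans f0)].
- by apply: P0 => y /fg /andP[].
rewrite big_seq [leRHS]big_seq; apply: ler_prod => y /fg /andP[f0 fgy].
by rewrite addr_ge0 //= lerD2l.
Qed.

Lemma recursion_le (f : X -> R) s : (forall y, y \in s -> 0 <= f y) ->
  lam / \prod_(y <- s) (1 + f y) <= lam.
Proof.
move=> f0; have := @recursion_antitone (fun=> 0) f s.
rewrite [X in _ -> _ <= _ / X]big1 ?divr1; last by move=> y _; rewrite addr0.
by apply=> y /f0 ->; rewrite lexx.
Qed.

Lemma recursion_ge (f : X -> R) s : (size s <= Delta)%N ->
  (forall y, y \in s -> 0 <= f y <= lam) ->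
  ratio_min <= lam / \prod_(y <- s) (1 + f y).
Proof.
move=> sD f0; apply: le_trans (recursion_antitone (g := fun=> lam) f0).
rewrite ler_pM2l // big_const_seq count_predT iter_mulr_1.
have l1 : 1 <= 1 + lam by rewrite lerDl ltW.
rewrite lef_pV2 ?posrE ?exprn_gt0 ?(lt_le_trans ltr01 l1) //.
exact: ler_weXn2l.
Qed.

Lemma upper_le l x : upper l x <= lam.
Proof.
case: l => [|l]; first by rewrite /upper /=.
by rewrite upperS recursion_le // => y _; apply: boundary_ratio_ge0.
Qed.

Lemma rat_le x : x \in D -> rat x <= lam.
Proof.
move=> xD; rewrite ratE // recursion_le // => y yx.
by rewrite ltW // rat_gt0 // (D_ch xD).
Qed.

Lemma lower_le_rat_le_upper l x : x \in D -> lower l x <= rat x <= upper l x.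
Proof.
elim: l x => [|l IH] x xD.
  rewrite /lower /upper /= rat_le // andbT.
  case: eqP => [chx|_]; last exact/ltW/rat_gt0.
  by rewrite ratE // chx big_nil divr1.
rewrite upperS lowerS ratE //; apply/andP; split; apply: recursion_antitone => y yx.
  have yD := D_ch xD yx; have /andP[_ ->] := IH y yD.
  by rewrite ltW ?rat_gt0.
have yD := D_ch xD yx; have /andP[-> _] := IH y yD.
by rewrite boundary_ratio_ge0.
Qed.

Lemma ratio_min_gt0 : 0 < ratio_min.
Proof. by rewrite divr_gt0 // exprn_gt0 // addr_gt0. Qed.

Lemma ratio_min_le_lower l x : x \in D -> ratio_min <= lower l.+1 x.
Proof.
move=> xD; rewrite lowerS; apply: recursion_ge; first exact: size_ch.
by move=> y _; rewrite upper_le boundary_ratio_ge0.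
Qed.

Lemma lower_le_upper l x : x \in D -> lower l x <= upper l x.
Proof. by move=> /(lower_le_rat_le_upper l)/andP[/le_trans]; apply. Qed.

Lemma ln_prod (f : X -> R) s : (forall y, 0 < f y) ->
  ln (\prod_(y <- s) f y) = \sum_(y <- s) ln (f y).
Proof.
move=> f0; elim: s => [|y s IH]; first by rewrite !big_nil ln1.
by rewrite !big_cons lnM ?IH // posrE ?prodr_gt0.
Qed.

(** By the choice of [upper] and [lower] all terms are nonnegative: the effects of
    the children on the root add up without cancellation. *)
Lemma log_gapE l x :
  log_gap l x = \sum_(y <- ch x) (ln (1 + upper l y) - ln (1 + lower l y)).
Proof.
have P0 c s : 0 < \prod_(y <- s) (1 + boundary_ratio c l y).
  by rewrite prodr_gt0 // => y _; rewrite ltr_pwDl ?boundary_ratio_ge0.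
rewrite /log_gap upperS lowerS !ln_div ?posrE ?P0 // !ln_prod;
  try by move=> y; rewrite ltr_pwDl ?boundary_ratio_ge0.
by rewrite sumrB; ring.
Qed.

Lemma rat_ge0 x : x \in D -> 0 <= rat x.
Proof. by move/rat_gt0/ltW. Qed.

Lemma path_weight_ge0 k x : x \in D -> 0 <= path_weight k x.
Proof.
elim: k x => [|k IH] x xD //=; rewrite big_seq sumr_ge0 // => y yx.
by rewrite mulr_ge0 ?occupation_ge0 ?rat_ge0 ?IH // (D_ch xD).
Qed.

Lemma path_weight_le k x : x \in D -> path_weight k x <= Delta%:R ^+ k.
Proof.
elim: k x => [|k IH] x xD /=; first by rewrite expr0.
apply: (@le_trans _ _ (\sum_(y <- ch x) Delta%:R ^+ k)).
  rewrite big_seq [leRHS]big_seq; apply: ler_sum => y yx.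
  have yD := D_ch xD yx; rewrite -[leRHS]mul1r.
  by rewrite ler_pM ?occupation_ge0 ?occupation_le1 ?rat_ge0 ?path_weight_ge0 ?IH.
rewrite big_const_seq count_predT iter_addr_0 exprS -[leLHS]mulr_natl.
by rewrite ler_wpM2r ?exprn_ge0 // ler_nat size_ch.
Qed.

Lemma influenceE n x : influence n x = \sum_(k < n.+1) path_weight k x.
Proof.
elim: n x => [|n IH] x; first by rewrite big_ord1.
rewrite big_ord_recl /=; congr (_ + _).
under [RHS]eq_bigr => i _ do rewrite add0n.
rewrite exchange_big /=; apply: eq_bigr => y _.
by rewrite IH mulr_sumr.
Qed.

Lemma influence_ge0 n x : x \in D -> 0 <= influence n x.
Proof.
by move=> xD; rewrite influenceE sumr_ge0 // => k _; apply: path_weight_ge0.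
Qed.

Hypothesis alpha_ge0 : 0 <= alpha.
Hypothesis alpha_lt1 : alpha < 1.
Hypothesis C_gt0 : 0 < C.
Hypothesis mixing : forall l x, x \in D ->
  `|boundary_ratio true l x - boundary_ratio false l x| <= C * alpha ^+ l.+1.

Lemma upper_le_lower_add l x : x \in D -> upper l x <= lower l x + C * alpha ^+ l.+1.
Proof.
move=> xD; rewrite -lerBlDl; apply: le_trans (mixing l xD).
rewrite /upper /lower; case: (odd l) => /=; first exact: ler_norm.
by rewrite distrC ler_norm.
Qed.

(** The constant M with p <= p' (1 + M alpha^j) at distance j from the boundary,
    where p' is the occupation probability at the lower ratio. *)
Definition distortion : R := C * (1 + ratio_min) / ratio_min.

Lemma distortion_ge0 : 0 <= distortion.
Proof.
have f0 := ltW ratio_min_gt0.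
by rewrite divr_ge0 // mulr_ge0 ?(ltW C_gt0) // addr_ge0.
Qed.

(** The factor by which the gap at the root bounds the paths of length l + 2: its
    first part is the case l = 0, and each further level costs the factor
    1 + M alpha^(j + 2) that compares p with p' there. *)
Definition comparison l : R :=
  Delta%:R / ln (1 + lam) * \prod_(j < l) (1 + distortion * alpha ^+ j.+2).

Lemma ln_lam_gt0 : 0 < ln (1 + lam).
Proof. by rewrite ln_gt0 // ltrDl. Qed.

Lemma comparison_ge0 l : 0 <= comparison l.
Proof.
rewrite mulr_ge0 ?divr_ge0 ?(ltW ln_lam_gt0) // prodr_ge0 // => j _.
by rewrite addr_ge0 // mulr_ge0 ?distortion_ge0 ?exprn_ge0.
Qed.

Lemma path_weightS k x : path_weight k.+1 x =
  \sum_(y <- ch x) occupation (rat y) * path_weight k y.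
Proof. by []. Qed.

(** For l = 0 each child y of x that has children itself contributes
    ln (1 + lam) to the gap, and at most Delta paths.  The induction step
    compares occupation probabilities at the true and at the lower ratio and
    applies concavity at each child. *)
Lemma path_weight_log_gap l x : x \in D ->
  path_weight l.+2 x <= comparison l * log_gap l x.
Proof.
elim: l x => [|l IH] x xD; rewrite path_weightS log_gapE mulr_sumr big_seq [leRHS]big_seq;
  apply: ler_sum => y yx; have yD := D_ch xD yx.
  apply: (@le_trans _ _ (path_weight 1 y)).
    rewrite -[leRHS]mul1r ler_pM ?occupation_ge0 ?occupation_le1 ?rat_ge0 //.
    exact: path_weight_ge0.
  rewrite /comparison big_ord0 mulr1 /upper /lower /=.
  have [->|_] := eqVneq (ch y) [::].
    by rewrite big_nil subrr mulr0.
  rewrite addr0 ln1 subr0 -mulrA mulVf ?gt_eqF ?ln_lam_gt0 // mulr1.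
  by have := path_weight_le 1 yD; rewrite expr1.
(* The child y is at distance l + 2 from the boundary. *)
apply: (@le_trans _ _ (occupation (lower l.+1 y) *
    (1 + distortion * alpha ^+ l.+2) * (comparison l * log_gap l y))).
  apply: ler_pM; rewrite ?occupation_ge0 ?rat_ge0 ?path_weight_ge0 ?IH //.
  have /andP[lr rh] := lower_le_rat_le_upper l.+1 yD.
  have := le_occupation ratio_min_gt0 (ratio_min_le_lower l yD) lr
    (le_trans rh (upper_le_lower_add l.+1 yD)).
  congr (_ <= _ * (1 + _)); rewrite /distortion.
  by rewrite [RHS]mulrAC; congr (_ / _); rewrite mulrAC.
have := ln1D_increment (lt_le_trans ratio_min_gt0 (ratio_min_le_lower l yD))
  (lower_le_upper l.+1 yD).
move/(ler_wpM2l (comparison_ge0 l.+1)); apply: le_trans.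
rewrite le_eqVlt; apply/orP; left; apply/eqP.
rewrite /comparison big_ord_recr /= /log_gap /occupation; ring.
Qed.

Lemma log_gap_le l x : x \in D -> log_gap l x <= C / ratio_min * alpha ^+ l.+2.
Proof.
move=> xD; have lo0 := lt_le_trans ratio_min_gt0 (ratio_min_le_lower l xD).
have hi0 := lt_le_trans lo0 (lower_le_upper l.+1 xD).
rewrite /log_gap -ln_div ?posrE //.
have -> : upper l.+1 x / lower l.+1 x = 1 + (upper l.+1 x / lower l.+1 x - 1) by ring.
apply: le_trans (le_ln1Dx _) _.
  by have := divr_gt0 hi0 lo0; lra.
have -> : upper l.+1 x / lower l.+1 x - 1 = (upper l.+1 x - lower l.+1 x) / lower l.+1 x.
  by field; rewrite gt_eqF.
have d := upper_le_lower_add l.+1 xD.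
apply: (@le_trans _ _ (C * alpha ^+ l.+2 / lower l.+1 x)).
  by rewrite ler_pM2r ?invr_gt0 // lerBlDl.
rewrite mulrAC ler_wpM2r ?exprn_ge0 // ler_pM2l // lef_pV2 ?posrE ?ratio_min_gt0 //.
exact: ratio_min_le_lower.
Qed.

(** The product of the 1 + M alpha^j is at most the exponential of a geometric
    series. *)
Lemma comparison_le l : comparison l <=
  Delta%:R / ln (1 + lam) * expR (distortion / (1 - alpha)).
Proof.
rewrite ler_wpM2l ?divr_ge0 ?(ltW ln_lam_gt0) //.
apply: (@le_trans _ _ (\prod_(j < l) expR (distortion * alpha ^+ j))).
  apply: ler_prod => j _; apply/andP; split.
    by rewrite addr_ge0 // mulr_ge0 ?distortion_ge0 ?exprn_ge0.
  apply: le_trans (expR_ge1Dx _).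
  rewrite lerD2l ler_wpM2l ?distortion_ge0 //.
  by rewrite ler_wiXn2l ?(ltW alpha_lt1) // -addn2 leq_addr.
rewrite -expR_sum ler_expR -mulr_sumr ler_wpM2l ?distortion_ge0 //.
exact: sum_geometric_le.
Qed.

(** The three parts bound the paths of length 0, of length 1, and of length at
    least 2. *)
Definition influence_bound : R := 1 + Delta%:R +
  Delta%:R / ln (1 + lam) * expR (distortion / (1 - alpha)) *
    (C / ratio_min) / (1 - alpha).

Lemma influence_le n x : x \in D -> influence n x <= influence_bound.
Proof.
move=> xD.
have le2 : influence n x <= \sum_(k < n.+2) path_weight k x.
  by rewrite influenceE [leRHS]big_ord_recr lerDl; apply: path_weight_ge0.
apply: le_trans le2 _; rewrite 2!big_ord_recl addrA; apply: lerD.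
  by rewrite lerD2l; have := path_weight_le 1 xD; rewrite expr1.
set B := _ * expR _.
have B0 : 0 <= B.
  by rewrite mulr_ge0 ?divr_ge0 ?(ltW ln_lam_gt0) ?expR_ge0.
have cf0 : 0 <= C / ratio_min by rewrite divr_ge0 ?(ltW C_gt0) ?(ltW ratio_min_gt0).
apply: (@le_trans _ _ (\sum_(k < n) (B * (C / ratio_min)) * alpha ^+ k)).
  apply: ler_sum => k _.
  apply: le_trans (path_weight_log_gap k xD) _.
  apply: (@le_trans _ _ (B * (C / ratio_min * alpha ^+ k.+2))).
    apply: (@le_trans _ _ (B * log_gap k x)).
      rewrite ler_wpM2r ?comparison_le //.
      have lo0 := lt_le_trans ratio_min_gt0 (ratio_min_le_lower k xD).
      have hi0 := lt_le_trans lo0 (lower_le_upper k.+1 xD).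
      by rewrite subr_ge0 ler_ln ?posrE ?lower_le_upper.
    by rewrite ler_wpM2l ?log_gap_le.
  rewrite mulrA ler_wpM2l ?(mulr_ge0 B0 cf0) //.
  by rewrite ler_wiXn2l ?(ltW alpha_lt1) // -addn2 leq_addr.
rewrite -mulr_sumr ler_wpM2l ?(mulr_ge0 B0 cf0) //.
exact: sum_geometric_le.
Qed.

Lemma influence_bound_ge1 : 1 <= influence_bound.
Proof.
rewrite /influence_bound -addrA lerDl addr_ge0 // divr_ge0 ?subr_ge0 ?(ltW alpha_lt1) //.
by rewrite !mulr_ge0 ?invr_ge0 ?expR_ge0 ?(ltW ln_lam_gt0) ?(ltW C_gt0) ?(ltW ratio_min_gt0).
Qed.

End TreeRecursion.

(** * The independence polynomial and its ratios on induced subgraphs *)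
Section SubsetPartition.
Variables (K : fieldType) (G : sgraph) (le : rel G) (lam : K).
Implicit Types (S I : {set G}) (v : G).

Definition Zsub S : K := \sum_(I : {set G} | indep I && (I \subset S)) lam ^+ #|I|.

Lemma indepP I : reflect (forall x y, x \in I -> y \in I -> ~~ adj x y) (indep I).
Proof.
apply: (iffP forall_inP) => [h x y xI yI|h x xI].
  by have /forall_inP := h x xI; apply.
by apply/forall_inP => y; apply: h.
Qed.

Lemma ZsubT : Zsub setT = Z G lam.
Proof. by apply: eq_bigl => I; rewrite subsetT andbT. Qed.

Lemma Zsub0 : Zsub set0 = 1.
Proof.
rewrite /Zsub (big_pred1 set0) ?cards0 ?expr0 // => I /=.
rewrite subset0; case: eqP => [->|]; rewrite ?andbF // andbT.
by apply/indepP => x y; rewrite inE.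
Qed.

Lemma saw_sub0 S v : saw_sub le S v 0 = S :\ v.
Proof. by rewrite /saw_sub take0; congr (_ :\: _); apply/setP => u; rewrite !inE. Qed.

Lemma saw_sub_size S v :
  saw_sub le S v (size (nbrs le S v)) = [set u in S :\ v | ~~ adj v u].
Proof.
apply/setP => u; rewrite /saw_sub take_size !inE mem_nbrs negb_or.
by case: (u \in S); rewrite ?andbF ?andbT //= andbT.
Qed.

Lemma saw_subS S v i : (i < size (nbrs le S v))%N ->
  saw_sub le S v i.+1 = saw_sub le S v i :\ nth v (nbrs le S v) i.
Proof.
move=> lti; apply/setP => u; rewrite /saw_sub (take_nth v lti) !inE mem_rcons inE.
by rewrite !negb_or; case: (u == v); rewrite //= ?andbF //= andbA.
Qed.

(** The independent sets are split according to whether they contain v; [saw_sub]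
    with index 0 removes v, and with the largest index all of its closed
    neighbourhood. *)
Lemma Zsub_rec S v : v \in S ->
  Zsub S = Zsub (saw_sub le S v 0)
           + lam * Zsub (saw_sub le S v (size (nbrs le S v))).
Proof.
move=> vS; rewrite saw_sub0 saw_sub_size /Zsub (bigID (fun I => v \in I)) [RHS]addrC /=.
congr (_ + _); last first.
  by apply: eq_bigl => I; rewrite subsetD1 andbA.
rewrite mulr_sumr (reindex_onto (fun I => v |: I) (fun I => I :\ v)) /=; last first.
  by move=> I /andP[_ vI]; rewrite setD1K.
apply: eq_big => [I|I].
  rewrite setU11 andbT; apply/andP/andP.
    case=> /andP[/indepP iI]; rewrite subUset sub1set vS /= => IS /eqP vI.
    have vnI : v \notin I by rewrite -vI !inE eqxx.
    split; first by apply/indepP => x y xI yI; apply: iI; rewrite !inE ?xI ?yI orbT.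
    apply/subsetP => x xI; rewrite !inE (subsetP IS) // andbT.
    rewrite (contraNneq _ vnI) => [/=|<-//].
    by apply: iI; rewrite !inE ?eqxx ?xI ?orbT.
  case=> /indepP iI /subsetP IS.
  have vnI : v \notin I by apply/negP => /IS; rewrite !inE eqxx.
  rewrite subUset sub1set vS setU1K // eqxx; split=> //=; apply/andP; split.
    apply/indepP => x y; rewrite !inE => /orP[/eqP->|xI] /orP[/eqP->|yI].
    - by rewrite adj_irr.
    - by have := IS y yI; rewrite !inE => /andP[].
    - by have := IS x xI; rewrite !inE adj_sym => /andP[].
    - exact: iI.
  by apply/subsetP => x /IS; rewrite !inE => /andP[/andP[]].
case/andP=> _ /eqP vI; have vnI : v \notin I by rewrite -vI !inE eqxx.
by rewrite cardsU1 vnI exprS.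
Qed.

Definition vertex_ratio S v : K :=
  lam * Zsub (saw_sub le S v (size (nbrs le S v))) / Zsub (saw_sub le S v 0).

(** The pair (S, v) stands for the vertex v of G[S], and so for the root of the
    tree of self-avoiding walks of G[S] at v. *)
Definition children (x : {set G} * G) : seq ({set G} * G) :=
  [seq (saw_sub le x.1 x.2 i, nth x.2 (nbrs le x.1 x.2) i)
  | i <- iota 0 (size (nbrs le x.1 x.2))].

Lemma Zsub_vertex_ratio S v : v \in S -> Zsub (saw_sub le S v 0) != 0 ->
  Zsub S = Zsub (saw_sub le S v 0) * (1 + vertex_ratio S v).
Proof.
by move=> vS Z0; rewrite (Zsub_rec vS) mulrDr mulr1 /vertex_ratio mulrCA mulfV // mulr1.
Qed.

(** The factors 1 + r_i are the quotients Z(G_i) / Z(G_i - v_i), where G_i - v_i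
    is G_{i+1}, and their product telescopes. *)
Lemma vertex_ratioE S v :
  (forall i, (i <= size (nbrs le S v))%N -> Zsub (saw_sub le S v i) != 0) ->
  vertex_ratio S v = lam / \prod_(y <- children (S, v)) (1 + vertex_ratio y.1 y.2).
Proof.
move=> Z0; rewrite /vertex_ratio /children big_map -mulrA -[RHS]/(lam * _).
congr (_ * _); set n := size _ in Z0 *.
pose f i := Zsub (saw_sub le S v i).
have step i : (0 <= i < n)%N ->
    1 + vertex_ratio (saw_sub le S v i) (nth v (nbrs le S v) i) = f i / f i.+1.
  move=> /= lti; rewrite /f (@Zsub_vertex_ratio _ (nth v (nbrs le S v) i)); last 2 first.
  - exact: mem_saw_sub.
  - by rewrite saw_sub0 -saw_subS // Z0.
  by rewrite saw_sub0 -saw_subS // [X in X / _]mulrC mulfK // Z0.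
rewrite -[n in iota _ n]subn0 -/(index_iota 0 n).
have [n0|n_gt0] := posnP n.
  by rewrite n0 big_nil invr1 divff // Z0.
rewrite /= (telescope_prodr_eq f _ n_gt0 _ step) ?invf_div // => k /andP[_ /ltnW kn].
by rewrite unitfE Z0.
Qed.

Definition node : {pred ({set G} * G)} := [pred x : {set G} * G | x.2 \in x.1].

Lemma mem_children (x y : {set G} * G) : x \in node -> y \in children x -> y \in node.
Proof.
move=> _; case/mapP=> i; rewrite mem_iota => lti ->; exact: mem_saw_sub.
Qed.

Lemma card_children (x y : {set G} * G) :
  x \in node -> y \in children x -> (#|y.1| < #|x.1|)%N.
Proof. by move=> xD /mapP[i _ ->]; apply: card_saw_sub. Qed.

Lemma size_children (x : {set G} * G) :
  (size (children x) <= #|[set u | adj x.2 u]|)%N.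
Proof.
rewrite size_map size_iota size_sort -cardE subset_leq_card //.
by apply/subsetP => u; rewrite !inE => /andP[].
Qed.

End SubsetPartition.

Section PartitionReal.
Variables (R : realType) (G : sgraph) (le : rel G) (lam : R).
Hypothesis lam_gt0 : 0 < lam.

Lemma Zsub_gt0 (S : {set G}) : 0 < Zsub lam S.
Proof.
rewrite /Zsub (bigD1 set0) /=; last first.
  by rewrite sub0set andbT; apply/indepP => x y; rewrite inE.
rewrite cards0 expr0 ltr_pwDl // sumr_ge0 // => I _.
by rewrite exprn_ge0 // ltW.
Qed.

Lemma vertex_ratio_gt0 (S : {set G}) v : 0 < vertex_ratio le lam S v.
Proof. by rewrite divr_gt0 ?mulr_gt0 ?Zsub_gt0. Qed.

End PartitionReal.

(** * Perturbation to complex parameters *)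
Section Perturbation.
Variable R : realType.
Implicit Types (x y a : R[i]).
Local Notation normc := Normc.normc.

Lemma normc_ge0 x : 0 <= normc x.
Proof. by case: x => a b; apply: sqrtr_ge0. Qed.

Lemma normcR (r : R) : 0 <= r -> normc r%:C = r.
Proof. by move=> r0; rewrite /= expr0n /= addr0 sqrtr_sqr ger0_norm. Qed.

Lemma normc_triangle x y : normc (x + y) <= normc x + normc y.
Proof. exact: le_normcD. Qed.

Lemma normc_opp x : normc (- x) = normc x.
Proof. exact: normcN. Qed.

Lemma normc_1D_ge a : 1 - normc a <= normc (1 + a).
Proof.
rewrite lerBlDr; have := normc_triangle (1 + a) (- a).
by rewrite addrK Normc.normc1 normc_opp.
Qed.

Lemma normc_1D_neq0 a : normc a < 1 -> 1 + a != 0.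
Proof.
move=> a1; apply/eqP => a0; have := normc_1D_ge a.
by rewrite a0 Normc.normc0; lra.
Qed.

Lemma perturb_step x a (e t : R) : normc (x - 1) <= e -> normc a <= t -> t < 1 ->
  normc (x / (1 + a) - 1) <= (e + t) / (1 - t).
Proof.
move=> xe a_t t1; have a1 : 1 + a != 0 by apply: normc_1D_neq0; apply: le_lt_trans t1.
have -> : x / (1 + a) - 1 = (x - 1 - a) / (1 + a) by field.
rewrite Normc.normcM Normc.normcV.
have d := normc_1D_ge a.
have t0 : 0 < 1 - t by lra.
apply: ler_pM; rewrite ?invr_ge0 ?normc_ge0 //.
  by apply: le_trans (normc_triangle _ _) _; rewrite normc_opp lerD.
rewrite lef_pV2 ?posrE //; lra.
Qed.

(** Relative errors accumulate no faster than in (1 + e) / (1 - sum b) - 1. *)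
Lemma perturb_prod (I : eqType) (s : seq I) (a : I -> R[i]) (b : I -> R) x e :
  (forall i, i \in s -> normc (a i) <= b i) -> \sum_(i <- s) b i < 1 ->
  normc (x - 1) <= e ->
  normc (x / (\prod_(i <- s) (1 + a i)) - 1) <=
    (e + \sum_(i <- s) b i) / (1 - \sum_(i <- s) b i).
Proof.
elim: s x e => [|i s IH] x e ab; first by rewrite !big_nil subr0 !divr1 addr0.
rewrite !big_cons => b1 xe.
have abi : normc (a i) <= b i by apply: ab; rewrite inE eqxx.
have abs j : j \in s -> normc (a j) <= b j by move=> js; apply: ab; rewrite inE js orbT.
have bi0 : 0 <= b i by apply: le_trans abi; apply: normc_ge0.
have s0 : 0 <= \sum_(j <- s) b j.
  rewrite big_seq sumr_ge0 // => j /abs; apply: le_trans; exact: normc_ge0.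
have e0 : 0 <= e by apply: le_trans xe; apply: normc_ge0.
set t := \sum_(j <- s) b j in IH b1 s0 *.
rewrite invfM mulrA.
have bi1 : b i < 1 by lra.
have t1 : t < 1 by lra.
apply: le_trans (IH _ _ abs t1 (perturb_step xe abi bi1)) _.
have -> : ((e + b i) / (1 - b i) + t) / (1 - t) =
   ((e + b i) + t * (1 - b i)) / ((1 - b i) * (1 - t)).
  by field; rewrite !gt_eqF //; lra.
have bt := mulr_ge0 bi0 s0.
have le_num : (e + b i) + t * (1 - b i) <= e + (b i + t).
  by rewrite mulrBr mulr1; lra.
have le_den : 1 - (b i + t) <= (1 - b i) * (1 - t).
  have -> : (1 - b i) * (1 - t) = 1 - (b i + t) + b i * t by ring.
  by rewrite lerDl.
have num0 : 0 <= (e + b i) + t * (1 - b i).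
  by rewrite !addr_ge0 // mulr_ge0 //; lra.
have den0 : 0 < 1 - (b i + t) by lra.
have den1 := lt_le_trans den0 le_den.
by apply: ler_pM; rewrite ?invr_ge0 ?(ltW den1) // lef_pV2.
Qed.

End Perturbation.

Section ZeroFree.
Variables (R : realType) (G : sgraph) (le : rel G) (lam H : R) (z : R[i]).
Local Notation normc := (@Normc.normc R).
Local Notation rat := (fun y : {set G} * G => vertex_ratio le lam y.1 y.2).
Local Notation infl := (influence (@children G le) rat).
Hypothesis lam_gt0 : 0 < lam.
Hypothesis influence_leH : forall n (x : {set G} * G), x \in @node G -> infl n x <= H.

(** With h <= H and delta = 1 / (2 H^2) one has (delta h)^2 <= delta / 2, which
    absorbs the second-order error in the induction. *)
Definition tolerance : R := (2 * H ^+ 2)^-1.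

Hypothesis z_near : normc (z / lam%:C - 1) <= tolerance / 2.

Lemma occ_ge0 x : 0 <= occupation (rat x).
Proof. by rewrite occupation_ge0 // ltW // vertex_ratio_gt0. Qed.

Lemma influence_ge1 n x : x \in @node G -> 1 <= infl n x.
Proof.
case: n => [|n] xD //=; rewrite lerDl big_seq sumr_ge0 // => y yx.
rewrite mulr_ge0 ?occ_ge0 //.
apply: (influence_ge0 (@mem_children G le)); last exact: mem_children yx.
by move=> w _; apply: vertex_ratio_gt0.
Qed.

(** A relative error of the ratio becomes, in 1 + r, the same error multiplied by
    the occupation probability. *)
Lemma one_add_vertex_ratio x :
  1 + vertex_ratio le z x.1 x.2 = (1 + rat x)%:C *
    (1 + (occupation (rat x))%:C * (vertex_ratio le z x.1 x.2 / (rat x)%:C - 1)).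
Proof.
have r0 : 0 < vertex_ratio le lam x.1 x.2 by apply: vertex_ratio_gt0.
rewrite /occupation rmorphM fmorphV !rmorphD /=.
have r1 : (vertex_ratio le lam x.1 x.2)%:C != 0 by rewrite (fmorph_eq0 (real_complex R)) gt_eqF.
have r2 : 1 + (vertex_ratio le lam x.1 x.2)%:C != 0.
  by rewrite -(rmorph1 (real_complex R)) -rmorphD fmorph_eq0 gt_eqF // addr_gt0.
by field; rewrite r1 r2.
Qed.

Lemma one_le_H x : x \in @node G -> 1 <= H.
Proof. by move=> xD; apply: le_trans (influence_ge1 0 xD) (influence_leH 0 xD). Qed.

Lemma tolerance_gt0 x : x \in @node G -> 0 < tolerance.
Proof. by move/one_le_H => H1; rewrite invr_gt0 mulr_gt0 ?exprn_gt0 //; lra. Qed.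

Lemma tolerance_influence n x : x \in @node G ->
  (tolerance * infl n x) ^+ 2 <= tolerance / 2 /\ tolerance * infl n x <= 2^-1.
Proof.
move=> xD; have H1 := one_le_H xD; have tol0 := tolerance_gt0 xD.
have infl1 := influence_ge1 n xD; have inflH := influence_leH n xD.
have tolH : tolerance * H ^+ 2 = 2^-1.
  by rewrite /tolerance; field; rewrite gt_eqF //; lra.
split.
  have -> : tolerance / 2 = tolerance ^+ 2 * H ^+ 2 by rewrite -tolH; ring.
  by rewrite exprMn ler_pM2l ?exprn_gt0 // ler_pXn2r // nnegrE; lra.
apply: (@le_trans _ _ (tolerance * H)); first by rewrite ler_pM2l.
by rewrite -tolH ler_pM2l // expr2 ler_peMr //; lra.
Qed.

(** Nonvanishing and the error bound support each other: the recursion for the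
    ratios divides by the partition functions of smaller sets, and the error
    bound keeps 1 + r_v away from 0. *)
Lemma vertex_ratio_near n (S : {set G}) : (#|S| <= n)%N -> Zsub z S != 0 /\
  forall v, v \in S ->
    normc (vertex_ratio le z S v / (vertex_ratio le lam S v)%:C - 1) <=
      tolerance * infl n (S, v).
Proof.
elim: n S => [|n IH] S Sn.
  move: Sn; rewrite leqn0 cards_eq0 => /eqP ->; split; last by move=> v; rewrite inE.
  by rewrite Zsub0 oner_neq0.
have near v : v \in S -> normc (vertex_ratio le z S v / (vertex_ratio le lam S v)%:C - 1) <=
      tolerance * infl n.+1 (S, v).
  move=> vS; have xD : (S, v) \in @node G := vS.
  have Zi i : (i <= size (nbrs le S v))%N -> Zsub z (saw_sub le S v i) != 0.
    by move=> _; apply: (IH _ _).1; rewrite -ltnS; apply: leq_trans Sn; apply: card_saw_sub.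
  pose a y := (occupation (rat y))%:C * (vertex_ratio le z y.1 y.2 / (rat y)%:C - 1).
  pose b y := occupation (rat y) * (tolerance * infl n y).
  have ab y : y \in children le (S, v) -> normc (a y) <= b y.
    move=> yS; have yD := mem_children xD yS.
    rewrite /a /b Normc.normcM normcR ?occ_ge0 //.
    apply: ler_wpM2l; first exact: occ_ge0.
    case: y yS yD => S' v' yS yD /=; apply: (IH S' _).2 => //.
    by rewrite -ltnS; apply: leq_trans Sn; apply: (card_children xD yS).
  have sb : \sum_(y <- children le (S, v)) b y = tolerance * infl n.+1 (S, v) - tolerance.
    rewrite /= mulrDr mulr1 addrAC subrr add0r mulr_sumr; apply: eq_bigr => y _.
    by rewrite /b mulrCA.
  have [th2 th1] := tolerance_influence n.+1 xD.
  have tol0 := tolerance_gt0 xD.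
  have infl1 := influence_ge1 n.+1 xD.
  set h := infl _ _ in sb infl1 th1 th2 *.
  have th0 : tolerance <= tolerance * h by rewrite ler_peMr // ltW.
  have s1 : \sum_(y <- children le (S, v)) b y < 1 by rewrite sb; lra.
  have := perturb_prod ab s1 z_near.
  rewrite sb; set s := _ - tolerance.
  have -> : z / lam%:C / \prod_(y <- children le (S, v)) (1 + a y) =
     vertex_ratio le z S v / (vertex_ratio le lam S v)%:C.
    rewrite (vertex_ratioE (le := le) Zi).
    rewrite (vertex_ratioE (le := le) (S := S) (v := v) (lam := lam)); last first.
      by move=> i _; rewrite gt_eqF // Zsub_gt0.
    have -> : \prod_(y <- children le (S, v)) (1 + vertex_ratio le z y.1 y.2) =
        \prod_(y <- children le (S, v)) ((1 + rat y)%:C * (1 + a y)).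
      by apply: eq_bigr => y _; apply: one_add_vertex_ratio.
    rewrite big_split /= rmorphM fmorphV rmorph_prod !invfM invrK.
    set P := \prod_(i <- _) (1 + rat i)%:C.
    have P0 : P != 0.
      rewrite prodf_seq_neq0; apply/allP => y _ /=.
      by rewrite (fmorph_eq0 (real_complex R)) gt_eqF // addr_gt0 // vertex_ratio_gt0.
    set A := (\prod_(i <- _) (1 + a i))^-1; set l := (lam%:C)^-1.
    by field.
  (* With u = delta h and s = u - delta, it remains to see that
     delta / 2 + s <= u (1 - s), which follows from u ^ 2 <= delta / 2. *)
  move/le_trans; apply; rewrite ler_pdivrMr; last by rewrite /s; lra.
  rewrite /s; set u := tolerance * h in th2 th1 th0 *.
  have : u * tolerance <= u * u by rewrite ler_wpM2l //; lra.
  have : 0 <= u * tolerance by apply: mulr_ge0; lra.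
  by move: th2; rewrite expr2; lra.
split=> //; have [->|[v vS]] := set_0Vmem S; first by rewrite Zsub0 oner_neq0.
have xD : (S, v) \in @node G := vS.
have Z0 : Zsub z (saw_sub le S v 0) != 0.
  by apply: (IH _ _).1; rewrite -ltnS; apply: leq_trans Sn; apply: card_saw_sub.
rewrite (Zsub_vertex_ratio vS Z0) mulf_neq0 // (one_add_vertex_ratio (S, v)) mulf_neq0 //.
  by rewrite (fmorph_eq0 (real_complex R)) gt_eqF // addr_gt0 // vertex_ratio_gt0.
apply: normc_1D_neq0; rewrite Normc.normcM normcR ?occ_ge0 //.
apply: (@le_lt_trans _ _ (1 * (tolerance * infl n.+1 (S, v)))).
  apply: ler_pM; rewrite ?occ_ge0 ?normc_ge0 ?near //.
  by rewrite occupation_le1 // ltW // vertex_ratio_gt0.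
rewrite mul1r; apply: (@le_lt_trans _ _ 2^-1).
  exact: (tolerance_influence n.+1 xD).2.
by rewrite invf_lt1 // ltr1n.
Qed.

End ZeroFree.

(** * Spheres around the root of a grafted graph *)

(** Being within distance k has a simpler recursion than being at distance
    exactly k, since it only asks for some walk. *)
Section Reach.
Variables (G : sgraph) (v : G).

Definition reach (k : nat) (u : G) : bool := [exists j : 'I_k.+1, walk v u j].

Lemma walkP u l :
  reflect (exists p, [/\ size p = l, path (@adj G) v p & last v p = u]) (walk v u l).
Proof.
apply: (iffP existsP) => [[p /andP[pp /eqP pl]]|[p [sp pp pl]]].
  by exists p; rewrite size_tuple.
by exists (tcast sp (in_tuple p)); rewrite val_tcast /= pp pl eqxx.
Qed.

Lemma walk0 u : walk v u 0 = (u == v).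
Proof.
apply/walkP/eqP => [[p [/size0nil -> _ <-]] //|->]; by exists [::].
Qed.

Lemma walkS u l : walk v u l.+1 = [exists y, walk v y l && adj y u].
Proof.
apply/walkP/existsP => [[p []]|[y /andP[/walkP[p [sp pp pl]] yu]]].
  case/lastP: p => // p u'; rewrite size_rcons rcons_path last_rcons.
  move=> [sp] /andP[pp pu] <-; exists (last v p); rewrite pu andbT.
  by apply/walkP; exists p.
by exists (rcons p u); rewrite size_rcons rcons_path last_rcons sp pp pl yu.
Qed.

Lemma reach0 u : reach 0 u = (u == v).
Proof.
rewrite -walk0; apply/existsP/idP => [[j]|w]; first by rewrite ord1.
by exists ord0.
Qed.

Lemma reach_walk k u : reach k.+1 u = reach k u || walk v u k.+1.
Proof.
apply/existsP/orP => [[j]|[/existsP[j wj]|w]].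
- case: (ltnP j k.+1) => [jk wj|kj]; first by left; apply/existsP; exists (Ordinal jk).
  have /eqP -> : nat_of_ord j == k.+1 by rewrite eqn_leq kj -ltnS ltn_ord.
  by right.
- by exists (widen_ord (leqnSn _) j).
- by exists ord_max.
Qed.

Lemma reachS k u : reach k.+1 u = reach k u || [exists y, reach k y && adj y u].
Proof.
apply/idP/orP.
  rewrite reach_walk => /orP[->|]; first by left.
  rewrite walkS => /existsP[y /andP[wy yu]]; right; apply/existsP; exists y.
  by rewrite yu andbT; apply/existsP; exists ord_max.
case=> [r|/existsP[y /andP[/existsP[j wy] yu]]]; first by rewrite reach_walk r.
have wu : walk v u j.+1 by rewrite walkS; apply/existsP; exists y; rewrite wy.
by apply/existsP; exists (lift ord0 j).
Qed.

Lemma reach_root k : reach k v.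
Proof. by elim: k => [|k IH]; rewrite ?reach0 // reach_walk IH. Qed.

Lemma mem_sphere l u :
  (u \in sphere v l) = reach l u && ((l == 0%N) || ~~ reach l.-1 u).
Proof.
rewrite inE; case: l => [|l] /=.
  rewrite andbT reach0 walk0 andb_idr // => _.
  by apply/forallP => -[].
rewrite reach_walk; case r: (reach l u) => /=.
  apply/negbTE/negP => /andP[_ /forallP nw].
  by case/existsP: r => j wj; have := nw j; rewrite wj.
rewrite andbT andb_idr // => _; apply/forallP => j.
by move/negbT: r => /existsPn; apply.
Qed.

Lemma root_sphere l : (v \in sphere v l) = (l == 0%N).
Proof. by rewrite mem_sphere !reach_root orbF. Qed.

Lemma sphere_0 u : (u \in sphere v 0) = (u == v).
Proof. by rewrite mem_sphere reach0 andbT. Qed.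

End Reach.

Section GraftSphere.
Variables A B : rgraph.

Lemma exists_sum (P : pred (A + B)) :
  [exists x, P x] = [exists a, P (inl a)] || [exists b, P (inr b)].
Proof.
apply/existsP/orP => [[[a|b] Px]|[/existsP[a Pa]|/existsP[b Pb]]].
- by left; apply/existsP; exists a.
- by right; apply/existsP; exists b.
- by exists (inl a).
- by exists (inr b).
Qed.

(** Walks may cross the new edge several times; being within reach is nevertheless
    decided by the shortest crossing, which goes through both roots. *)
Lemma graft_reach k :
  (forall a : A, reach (root (graft A B)) k (inl a : graft A B) = reach (root A) k a) /\
  (forall b : B, reach (root (graft A B)) k (inr b : graft A B) =
     (0 < k)%N && reach (root B) k.-1 b).
Proof.
elim: k => [|k [IHa IHb]]; first by split=> x; rewrite !reach0.
split=> [a|b]; rewrite reachS exists_sum; apply/idP/idP.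
- case/or3P => [|/existsP[a' /andP[]]|/existsP[b /and3P[_ /eqP -> _]]].
  + by rewrite IHa reachS => ->.
  + by rewrite IHa reachS => ra aa; apply/orP; right; apply/existsP; exists a'; rewrite ra.
  + exact: reach_root.
- rewrite reachS => /orP[ra|/existsP[a' /andP[ra aa]]]; first by rewrite IHa ra.
  by apply/or3P/Or32/existsP; exists a'; rewrite IHa ra.
- case/or3P => [|/existsP[a /andP[_ /andP[_ /eqP ->]]]|/existsP[b' /andP[]]] /=.
  + by rewrite IHb; case: k {IHa IHb} => //= k; rewrite reachS => ->.
  + exact: reach_root.
  + rewrite IHb; case: k {IHa IHb} => //= k rb bb; rewrite reachS; apply/orP; right.
    by apply/existsP; exists b'; rewrite rb.
rewrite /=; have [->|nb rb] := eqVneq b (root B).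
  move=> _; apply/or3P/Or32/existsP; exists (root A).
  by rewrite IHa reach_root /= !eqxx.
case: k IHa IHb rb => [|k] IHa IHb; first by rewrite reach0 (negbTE nb).
rewrite reachS => /orP[rb|/existsP[b' /andP[rb bb]]]; first by rewrite IHb rb.
by apply/or3P/Or33/existsP; exists b'; rewrite IHb rb.
Qed.

Lemma graft_sphere_inl l (a : A) :
  ((inl a : graft A B) \in sphere (root (graft A B)) l) = (a \in sphere (root A) l).
Proof. by rewrite !mem_sphere !(graft_reach _).1. Qed.

Lemma graft_sphere_inr l (b : B) :
  ((inr b : graft A B) \in sphere (root (graft A B)) l) =
  (0 < l)%N && (b \in sphere (root B) l.-1).
Proof.
rewrite !mem_sphere !(graft_reach _).2; case: l => [|[|l]] //=.
Qed.

End GraftSphere.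

Section Layered.

(** Spheres around the root are independent, so that every assignment of values
    to a sphere is a boundary condition. *)
Definition layered (A : rgraph) : Prop := forall l, indep (sphere (root A) l).

Lemma point_layered : layered point.
Proof. by move=> l; apply/indepP. Qed.

Lemma graft_layered A B : layered A -> layered B -> layered (graft A B).
Proof.
move=> LA LB l; apply/indepP => -[a|b] [a'|b'].
- rewrite !graft_sphere_inl; exact: indepP (LA l) a a'.
- rewrite graft_sphere_inl graft_sphere_inr => al /andP[l0 _] /=.
  apply/negP => /andP[/eqP ea _]; move: al; rewrite ea root_sphere => /eqP l1.
  by rewrite l1 in l0.
- rewrite graft_sphere_inl graft_sphere_inr => /andP[l0 _] al /=.
  apply/negP => /andP[/eqP ea _]; move: al; rewrite ea root_sphere => /eqP l1.
  by rewrite l1 in l0.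
- rewrite !graft_sphere_inr => /andP[_ bl] /andP[_ bl'].
  exact: indepP (LB l.-1) b b' bl bl'.
Qed.

Lemma join_root_layered (X : eqType) (T : X -> rgraph) (s : seq X) :
  (forall y, y \in s -> layered (T y)) -> layered (join_root [seq T y | y <- s]).
Proof.
elim: s => [|y s IH] LT /=; first exact: point_layered.
apply: graft_layered; last by apply: LT; rewrite inE eqxx.
by apply: IH => y' ys; apply: LT; rewrite inE ys orbT.
Qed.

End Layered.

(** * Weighted sums over independent sets of a grafted graph *)
Section TwoState.
Variable K : fieldType.

(** Each vertex x carries a weight w x true when it is in the set and w x false
    when it is not.  A vertex fixed to be out has weights 0 and 1, one fixed to be
    in has 1 and 0, and a free vertex has lambda and 1.  Boundary conditions become
    weights, and the sums factor over disjoint unions with no case distinction on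
    the domain. *)
Definition weight_sum (A : rgraph) (w : A -> bool -> K) (b : bool) : K :=
  \sum_(I : {set A} | indep I && ((root A \in I) == b)) \prod_x w x (x \in I).

Lemma eq_weight_sum (A : rgraph) (w w' : A -> bool -> K) b :
  (forall x c, w x c = w' x c) -> weight_sum w b = weight_sum w' b.
Proof. by move=> ww; apply: eq_bigr => I _; apply: eq_bigr => x _; apply: ww. Qed.

Section GraftSum.
Variables A B : rgraph.

Definition union_graft (J : {set A} * {set B}) : {set graft A B} :=
  [set x : graft A B | match x with inl a => a \in J.1 | inr b => b \in J.2 end].

Lemma union_graft_bij : bijective union_graft.
Proof.
exists (fun I : {set graft A B} => ([set a | (inl a : graft A B) \in I],
                                    [set b | (inr b : graft A B) \in I])).
  by move=> [J1 J2]; congr (_, _); apply/setP => x; rewrite !inE.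
by move=> I; apply/setP => -[a|b]; rewrite !inE.
Qed.

Lemma indep_union_graft J : indep (union_graft J) =
  [&& indep J.1, indep J.2 & ~~ ((root A \in J.1) && (root B \in J.2))].
Proof.
apply/indepP/and3P => [iJ|[/indepP iA /indepP iB nr] [a|b] [a'|b']]; rewrite ?inE.
- split.
  + by apply/indepP => x y xJ yJ; apply: (iJ (inl x) (inl y)); rewrite inE.
  + by apply/indepP => x y xJ yJ; apply: (iJ (inr x) (inr y)); rewrite inE.
  apply/negP => /andP[rA rB].
  by have := iJ (inl (root A)) (inr (root B)); rewrite !inE rA rB /= !eqxx => /(_ isT isT).
- exact: iA.
- move=> aJ bJ /=; apply: contra nr => /andP[/eqP <- /eqP <-]; exact/andP.
- move=> bJ aJ /=; apply: contra nr => /andP[/eqP <- /eqP <-]; exact/andP.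
- exact: iB.
Qed.

Lemma weight_sum_graft (w : graft A B -> bool -> K) b :
  weight_sum w b = weight_sum (fun x => w (inl x)) b *
    (weight_sum (fun x => w (inr x)) false +
     if b then 0 else weight_sum (fun x => w (inr x)) true).
Proof.
(* Only when the root of A is in the set must the root of B be out. *)
have -> : weight_sum (fun x => w (inr x)) false +
     (if b then 0 else weight_sum (fun x => w (inr x)) true) =
   \sum_(I : {set B} | indep I && ~~ (b && (root B \in I))) \prod_x w (inr x) (x \in I).
  rewrite [RHS](bigID (fun I : {set B} => root B \in I)) addrC /=; congr (_ + _).
    case: b => /=.
      by rewrite big_pred0 // => I; case: (root B \in I); rewrite ?andbF.
    by apply: eq_bigl => I; rewrite andbT eqb_id.
  by apply: eq_bigl => I; case: (root B \in I); rewrite ?andbF ?andbT.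
rewrite big_distrlr pair_big /weight_sum (reindex _ (onW_bij _ union_graft_bij)).
apply: eq_big => [[I J]|[I J] _].
  rewrite indep_union_graft inE /=.
  by case: (root A \in I); case: b; rewrite ?andbF ?andbT //= !andbT.
rewrite big_sumType /=.
by congr (_ * _); apply: eq_bigr => x _; rewrite inE.
Qed.

End GraftSum.

Lemma weight_sum_point (w : point -> bool -> K) b : weight_sum w b = w tt b.
Proof.
rewrite /weight_sum (big_pred1 [set x : point | b]) => [|I].
  by rewrite (big_pred1 tt) ?inE // => -[].
have -> /= : indep I by apply/indepP.
apply/eqP/eqP => [<-|->]; last by rewrite inE.
by apply/setP => -[]; rewrite inE.
Qed.

End TwoState.

(** * Ratios with constant values on a sphere *)
Section SphereBoundary.
Variables (R : realType) (lam : R).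
Hypothesis lam_gt0 : 0 < lam.
Implicit Types (A B : rgraph) (c b : bool) (l : nat).

Definition level_weight A c l (x : A) b : R :=
  if x \in sphere (root A) l then (b == c)%:R else if b then lam else 1.

Definition level_sum A c l b : R := weight_sum (@level_weight A c l) b.

Lemma level_sum_graft A B c l b : level_sum (graft A B) c l.+1 b =
  level_sum A c l.+1 b *
    (level_sum B c l false + if b then 0 else level_sum B c l true).
Proof.
rewrite /level_sum weight_sum_graft; congr (_ * (_ + _)).
- apply: eq_weight_sum => x d; rewrite /level_weight.
  by rewrite graft_sphere_inl.
- apply: eq_weight_sum => x d; rewrite /level_weight.
  by rewrite graft_sphere_inr.
- case: b => //; apply: eq_weight_sum => x d; rewrite /level_weight.
  by rewrite graft_sphere_inr.
Qed.

Lemma level_sum_join ts c l b : level_sum (join_root ts) c l.+1 b =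
  (if b then lam else 1) *
  \prod_(t <- ts) (level_sum t c l false + if b then 0 else level_sum t c l true).
Proof.
elim: ts => [|t ts IH] /=.
  by rewrite /level_sum weight_sum_point big_nil mulr1 /level_weight root_sphere.
by rewrite level_sum_graft IH big_cons -mulrA; congr (_ * _); rewrite mulrC.
Qed.

Lemma level_weight_ge0 A c l x b : 0 <= @level_weight A c l x b.
Proof. by rewrite /level_weight; case: ifP => // _; case: b; rewrite ?(ltW lam_gt0). Qed.

Lemma level_sum_ge0 A c l b : 0 <= level_sum A c l b.
Proof.
by rewrite sumr_ge0 // => I _; rewrite prodr_ge0 // => x _; apply: level_weight_ge0.
Qed.

(** The set containing exactly the vertices that the boundary condition puts in
    has weight 1.  It contains the root only if l = 0 and c = 1. *)
Lemma level_sum_gt0 A c l : layered A ->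
  0 < level_sum A c l (c && (l == 0%N)).
Proof.
move=> LA; pose J := [set x in sphere (root A) l | c].
have memJ x : (x \in J) = (x \in sphere (root A) l) && c by rewrite in_set.
rewrite /level_sum /weight_sum (bigD1 J) /=; last first.
  rewrite memJ root_sphere [c && _]andbC eqxx andbT; apply/indepP => x y.
  by rewrite !memJ => /andP[xl _] /andP[yl _]; apply: (indepP _ (LA l)).
rewrite ltr_pwDl //; last first.
  by rewrite sumr_ge0 // => I _; rewrite prodr_ge0 // => x _; apply: level_weight_ge0.
apply: prodr_gt0 => x _; rewrite /level_weight memJ.
by case: (x \in _); rewrite //= eqxx.
Qed.

(** On the sphere of radius 0 the root itself carries the value c. *)
Lemma level_sum0 A c : level_sum A c 0 (~~ c) = 0.
Proof.
rewrite /level_sum /weight_sum big1 // => I /andP[_ /eqP rI].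
rewrite (bigD1 (root A)) //= /level_weight sphere_0 eqxx rI.
by case: c {rI}; rewrite mul0r.
Qed.

Definition level_ratio A c l : R := level_sum A c l true / level_sum A c l false.

Lemma level_ratio_join_1 (X : eqType) (T : X -> rgraph) (s : seq X) c :
  (forall y, y \in s -> layered (T y)) ->
  level_ratio (join_root [seq T y | y <- s]) c 1 =
  if c && (s != [::]) then 0 else lam.
Proof.
move=> LT; rewrite /level_ratio !level_sum_join !big_map mul1r -mulrA.
case: c => /=; last first.
  under eq_bigr => t _ do rewrite addr0.
  under [X in _ / X]eq_bigr => t _ do rewrite (@level_sum0 _ false) addr0.
  rewrite divff ?mulr1 // gt_eqF // big_seq prodr_gt0 // => y ys.
  exact: (@level_sum_gt0 _ false 0 (LT y ys)).
case: s {LT} => [|y s] /=; first by rewrite !big_nil divr1 mulr1.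
by rewrite big_cons (@level_sum0 _ true) addr0 !mul0r mulr0.
Qed.

Lemma level_ratio_join (X : eqType) (T : X -> rgraph) (s : seq X) c l :
  (forall y, y \in s -> layered (T y)) ->
  level_ratio (join_root [seq T y | y <- s]) c l.+2 =
  lam / \prod_(y <- s) (1 + level_ratio (T y) c l.+1).
Proof.
move=> LT; rewrite /level_ratio !level_sum_join !big_map mul1r -mulrA -prodf_div -prodfV.
congr (_ * _); rewrite big_seq [RHS]big_seq; apply: eq_bigr => y ys.
have t0 := @level_sum_gt0 (T y) c l.+1 (LT y ys).
rewrite andbF in t0.
have t1 := level_sum_ge0 (T y) c l.+1 true.
by rewrite addr0; field; rewrite !gt_eqF // ltr_pwDl.
Qed.

Section Condition.
Variables (A : rgraph) (c : bool) (l : nat).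
Hypothesis LA : layered A.

Definition sphere_value (x : A) : option bool :=
  if x \in sphere (root A) l then Some c else None.

Lemma sphere_value_indep : indep [set x | sphere_value x == Some true].
Proof.
apply/indepP => x y; rewrite !inE /sphere_value.
by case: ifP => // xl _; case: ifP => // yl _; apply: (indepP _ (LA l)).
Qed.

Definition sphere_bc : boundary_condition A := BoundaryCondition sphere_value_indep.

Lemma sphere_bc_dom : bc_dom sphere_bc = sphere (root A) l.
Proof. by apply/setP => x; rewrite in_set /= /sphere_value; case: ifP. Qed.

End Condition.

(** A set I of free vertices corresponds to the independent set obtained by adding
    the vertices fixed to be in; all other independent sets have weight 0. *)
Lemma constrained_sum A (sigma : boundary_condition A) b : sigma (root A) = None ->
  \sum_(I : {set A} | [&& (root A \in I) == b, I \subset ~: bc_dom sigma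
                        & indep (I :|: bc_in sigma)]) lam ^+ #|I| =
  weight_sum (fun x d => if sigma x is Some s then (d == s)%:R
                         else if d then lam else 1) b.
Proof.
move=> rN; rewrite /weight_sum.
rewrite [RHS](bigID (fun J : {set A} => J :&: bc_dom sigma == bc_in sigma)) /=.
rewrite [X in _ + X]big1 ?addr0; last first.
  move=> J /andP[_ /eqP/setP ne].
  have [x] : exists x, (x \in J :&: bc_dom sigma) != (x \in bc_in sigma).
    by apply/existsP; rewrite -negb_forall; apply/forallP => h; apply: ne => x; apply/eqP.
  rewrite !inE => xJ; rewrite (bigD1 x) //=.
  by case: (sigma x) xJ => [[]|]; case: (x \in J); rewrite //= ?mul0r.
have inN x : x \in bc_in sigma -> x \in bc_dom sigma.
  by rewrite !inE => /eqP ->.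
rewrite [RHS](reindex_onto (fun I : {set A} => I :|: bc_in sigma)
                           (fun J => J :\: bc_dom sigma)) /=; last first.
  move=> J /andP[_ /eqP <-]; apply/setP => x; rewrite !inE.
  by case: (x \in J); case: (sigma x).
apply: eq_big => [I|I].
  have rI : root A \in I :|: bc_in sigma = (root A \in I) by rewrite !inE rN orbF.
  rewrite rI -!andbA; case: (_ == b); rewrite ?andbF ?andbT //=.
  rewrite andbC; congr (_ && _); apply/idP/andP => [/subsetP sI|[_ /eqP <-]].
    have dI x : x \in bc_dom sigma -> x \notin I.
      by move=> xd; apply/negP => /sI; rewrite inE xd.
    split; apply/eqP/setP => x; rewrite !(in_setI, in_setD, in_setU);
      move: (dI x) (inN x);
      by case: (x \in I); case: (x \in bc_dom sigma); case: (x \in bc_in sigma)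
        => //= h1 h2; first [have := h1 isT | have := h2 isT].
  by apply/subsetP => x; rewrite !inE => /andP[].
case/and3P => _ /subsetP sI _.
rewrite -prodr_const [RHS](bigID (fun x => x \in I)) /= [X in _ * X]big1 ?mulr1.
  apply: eq_bigr => x xI; have := sI x xI; rewrite !inE xI negbK => /eqP ->.
  by [].
move=> x xI; rewrite !inE (negbTE xI) /=.
by case: (sigma x) => // s; case: s.
Qed.

Lemma ratio_sphere_bc A c l (LA : layered A) : (0 < l)%N ->
  ratio (sphere_bc c l LA) (root A) lam = level_ratio A c l.
Proof.
move=> l0; have rN : sphere_bc c l LA (root A) = None.
  by rewrite /= /sphere_value root_sphere eqn0Ngt l0.
have E b : level_sum A c l b = weight_sum (fun x d =>
    if sphere_bc c l LA x is Some s then (d == s)%:R else if d then lam else 1) b.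
  by apply: eq_weight_sum => x d; rewrite /level_weight /= /sphere_value; case: ifP.
rewrite /ratio /level_ratio !E -!constrained_sum //; congr (_ / _).
  by apply: eq_bigl => I; rewrite eqb_id.
by apply: eq_bigl => I; rewrite eqbF_neg.
Qed.

End SphereBoundary.

(** * Trees of self-avoiding walks and the theorem *)
Section SawTree.
Variables (G : sgraph) (le : rel G).

Lemma tsaw_join_root (x : {set G} * G) : x \in @node G ->
  tsaw le x.1 x.2 = join_root [seq tsaw le y.1 y.2 | y <- children le x].
Proof. by move=> xD; rewrite tsawE // -map_comp. Qed.

Lemma tsaw_layered (x : {set G} * G) : x \in @node G -> layered (tsaw le x.1 x.2).
Proof.
have [n] := ubnP #|x.1|; elim: n x => // n IH x xn xD.
rewrite tsaw_join_root //; apply: join_root_layered => y yx.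
apply: IH; last exact: mem_children yx.
by apply: leq_trans (card_children xD yx) _.
Qed.

Lemma level_ratio_tsaw (R : realType) (lam : R) c l (x : {set G} * G) :
  0 < lam -> x \in @node G ->
  level_ratio lam (tsaw le x.1 x.2) c l.+1 =
  boundary_ratio (@children G le) lam c l x.
Proof.
move=> lam0; elim: l x => [|l IH] x xD; rewrite tsaw_join_root //.
  by rewrite level_ratio_join_1 // => y yx; apply/tsaw_layered/(mem_children xD yx).
rewrite level_ratio_join //=; last first.
  by move=> y yx; apply/tsaw_layered/(mem_children xD yx).
congr (_ / _); rewrite big_seq [RHS]big_seq; apply: eq_bigr => y yx.
by rewrite IH // (mem_children xD yx).
Qed.

End SawTree.

(* The canonical topology lives on the alias R[i]^o of the complex numbers. *)
Theorem mainTheorem1 (R : realType)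
    (ord : forall G : sgraph, rel G)
    (ord_linear : forall G : sgraph, linear_order (ord G))
    (F : sgraph -> Prop)
    (F_bounded : bounded_degree F)
    (F_induced : induced_closed F)
    (lamstar : R) (lamstar_gt0 : 0 < lamstar)
    (F_VSSM : VSSM ord F lamstar) :
  exists U : set (R[i])^o,
    [/\ open U, U lamstar%:C &
      forall lam : R[i], U lam -> forall G : sgraph, F G -> Z G lam != 0].
Proof.
case: F_VSSM => alpha [C [alpha_ge0 alpha_lt1 C_gt0 mix]].
case: F_bounded => Delta _ deg.
pose H := influence_bound lamstar alpha C Delta.
have influence_leH (G : sgraph) : F G -> forall n (x : {set G} * G), x \in @node G ->
    influence (@children G (ord G)) (fun y => vertex_ratio (ord G) lamstar y.1 y.2) n x <= H.
  move=> FG n x xD.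
  apply: (influence_le lamstar_gt0 (@mem_children G (ord G))) => //.
  - by move=> y yD; apply: leq_trans (size_children _ _) (deg G FG y.2).
  - by move=> y _; apply: vertex_ratio_gt0.
  - case=> S v _; rewrite (@vertex_ratioE _ _ (ord G)) // => i _.
    by rewrite gt_eqF // Zsub_gt0.
  move=> l y yD; have Ly := tsaw_layered (ord G) yD.
  rewrite -!(level_ratio_tsaw _ _ _ lamstar_gt0 yD) -!(ratio_sphere_bc _ _ Ly) //.
  by apply: (mix G FG y.1 y.2 yD l.+1) => //; rewrite sphere_bc_dom.
(* The bound on z / lamstar - 1 required by the induction, as a radius. *)
pose r := lamstar * (tolerance H / 2).
have H1 : 1 <= H by apply: influence_bound_ge1.
have r0 : 0 < r by rewrite mulr_gt0 ?divr_gt0 // invr_gt0 mulr_gt0 ?exprn_gt0 //; lra.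
exists (ball (lamstar%:C : R[i]^o) r%:C); split.
- by apply: ball_open; rewrite ltcR.
- by apply: ballxx; rewrite ltcR.
move=> z zU G FG.
have znear : Normc.normc (z / lamstar%:C - 1) <= tolerance H / 2.
  have l0 : lamstar%:C != 0 by rewrite (fmorph_eq0 (real_complex R)) gt_eqF.
  have -> : z / lamstar%:C - 1 = - (lamstar%:C - z) / lamstar%:C by field.
  rewrite Normc.normcM Normc.normcV normc_opp normcR ?(ltW lamstar_gt0) //.
  rewrite ler_pdivrMr // mulrC ltW // -ltcR.
  by move: zU; rewrite -ball_normE.
by rewrite -ZsubT; apply: (vertex_ratio_near lamstar_gt0 (influence_leH G FG) znear (leqnn _)).1.
Qed.
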